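(* Let $f:\mathbb{R}_+^2\to\mathbb{R}$ be defined by $$f(a,b)=\begin{cases}\tilde f(a+b), & (a,b)\in A,\\ f_0(a,b), & (a,b)\in B,\end{cases}$$ where $f_0(a,b)=a\log a+b\log b+ab$ and $\tilde f(s)=f_0(\alpha(s),\beta(s))$ for $s\ge 2$, with $\alpha,\beta,A,B$ as given in the context. Then $\tilde f\in C^1([2,+\infty))$ and $f$ is the convex envelope of $f_0$ on $\mathbb{R}_+^2$, i.e. the largest convex function on $\mathbb{R}_+^2$ which is everywhere less than or equal to $f_0$.
   Context: $\mathbb{R}_+=[0,+\infty)$ and $0\log 0=0$. The functions $\alpha,\beta\in C^0([2,+\infty))$ are uniquely characterized by: $\alpha(2)=\beta(2)=1$; for every $s>2$, $0<\alpha(s)<s/2<\beta(s)$, $\alpha(s)+\beta(s)=s$ and $\log\alpha(s)+\beta(s)=\log\beta(s)+\alpha(s)$. (For $s>2$, $\alpha(s)$ and $\beta(s)$ are the two minimizers of $a\mapsto f_0(a,s-a)$ on $[0,s]$.) The set $A=\{(a,b)\in\mathbb{R}_+^2: a+b\ge 2,\ \alpha(a+b)\le a\le \beta(a+b)\}$ is the closed convex set lying above the curve $\{(\alpha(s),\beta(s)):s\ge2\}\cup\{(\beta(s),\alpha(s)):s\ge2\}$, and $B=\mathbb{R}_+^2\setminus A$. *)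

(* Defs.v *)
From HB Require Import structures.
From mathcomp Require Import all_boot all_order all_algebra.
From mathcomp Require Import all_classical all_reals all_analysis.

Set Implicit Arguments.
Unset Strict Implicit.
Unset Printing Implicit Defensive.

Import Order.TTheory GRing.Theory Num.Theory.
Import numFieldNormedType.Exports.

Local Open Scope classical_set_scope.
Local Open Scope ring_scope.

Section C1.
Context {R : realType}.
Implicit Types (D : set R) (F : R -> R).

(* The quotient is restricted to points of D, so that the derivative is
   one-sided at an endpoint of an interval D; F may be arbitrary outside D. *)
Definition has_derivative_within D F (s l : R) : Prop :=
  (F t - F s) / (t - s) @[t --> within D s^'] --> l.

Definition C1_on D F : Prop :=
  exists F' : R -> R,
    {within D, continuous F'} /\
    forall s, D s -> has_derivative_within D F s (F' s).

End C1.

(* R^o carries the module structure over R required by convex_function. *)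
Definition quadrant (R : realType) : set (R^o * R^o) :=
  [set p | 0 <= p.1 /\ 0 <= p.2].

(* Functions on D are represented by total functions; only their values on D
   matter, both for convexity and for the comparisons. *)
Definition is_convex_envelope (R : realType) (E : lmodType R) (D : set E)
    (f g : E -> R) : Prop :=
  [/\ convex_function D f,
      forall x, D x -> f x <= g x
    & forall h : E -> R, convex_function D h ->
        (forall x, D x -> h x <= g x) -> forall x, D x -> h x <= f x].

Section Functions.
Context {R : realType}.
Implicit Types (alpha beta : R -> R) (p : R^o * R^o).

(* The convention 0 log 0 = 0 holds because of the left factor. *)
Definition f0 p : R := p.1 * ln p.1 + p.2 * ln p.2 + p.1 * p.2.

Definition alpha_beta_spec alpha beta : Prop :=
  [/\ {within `[2, +oo[, continuous alpha},
      {within `[2, +oo[, continuous beta},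
      alpha 2 = 1,
      beta 2 = 1
    & forall s : R, 2 < s ->
      [/\ 0 < alpha s, alpha s < s / 2, s / 2 < beta s,
          alpha s + beta s = s
        & ln (alpha s) + beta s = ln (beta s) + alpha s]].

Definition setA alpha beta : set (R^o * R^o) :=
  [set p | [/\ quadrant p, 2 <= p.1 + p.2,
               alpha (p.1 + p.2) <= p.1 & p.1 <= beta (p.1 + p.2)]].

Definition ftilde alpha beta (s : R) : R := f0 (alpha s, beta s).

(* On the quadrant, the second branch is the case of the points of
   B = quadrant `\` A. *)
Definition f alpha beta p : R :=
  if p \in setA alpha beta then ftilde alpha beta (p.1 + p.2) else f0 p.

End Functions.

(* Main.v *)
(** The envelope is recovered from its supporting planes: every affine minorant
    of [f0] lies below [f], because each point of [A] is on a segment between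
    [(alpha s, beta s)] and [(beta s, alpha s)], where [f0] takes the value
    [ftilde s].  It thus suffices that the tangent planes of [f0] at the interior
    points outside [A] and at the points of the curve lie below [f0]; the boundary
    of the quadrant has no tangent plane, but there [f0] reduces to [x ln x].
    Minimising [f0] minus its tangent plane at [(a, b)] over the second variable
    leaves a function of one variable, affine and decreasing in [b], so only the
    [b] on the curve matter; for those this function is convex, then concave, then
    convex, with double zeros at [a] and [b].  On the curve the tangent planes
    depend on [x + y] only, hence [s |-> ln (alpha s) + 1 + beta s] is a
    continuous subgradient of [ftilde], that is, its derivative. *)

Require Import Defs.
From HB Require Import structures.
From mathcomp Require Import all_boot all_order all_algebra.
From mathcomp Require Import all_classical all_reals all_analysis.
From mathcomp Require Import ring lra.
Import Order.TTheory GRing.Theory Num.Theory.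
Import numFieldNormedType.Exports.
Local Open Scope classical_set_scope.
Local Open Scope ring_scope.

Set Implicit Arguments.
Unset Strict Implicit.
Unset Printing Implicit Defensive.

(** * Sign of a function from its second derivative *)

Section MeanValue.
Context {R : realType}.
Implicit Types (g h dg ddg : R -> R) (x y z u : R).

Lemma is_derive_congr g h x (d e : R) :
  is_derive x 1 g d -> g =1 h -> d = e -> is_derive x 1 h e.
Proof. by move=> dg /funext <- <-. Qed.

Lemma mean_value g dg x y : x < y ->
    (forall z, x <= z <= y -> is_derive z 1 g (dg z)) ->
  exists2 z, x < z < y & g y - g x = dg z * (y - x).
Proof.
move=> xy dgP.
have [||c] := MVT xy (df := dg) (f := g).
- by move=> z; rewrite in_itv/= => /andP[xz zy]; apply: dgP; rewrite !ltW.
- apply: derivable_within_continuous => z; rewrite in_itv/= => xzy.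
  by have [] := dgP _ xzy.
by rewrite in_itv/=; exists c.
Qed.

(** By the mean value theorem, [dg] is nonpositive before [u] and nonnegative after it. Convexity is
    asked only between [u] and [x], since [slice] below is not convex throughout. *)
Lemma convex_ge_critical g dg ddg u x :
    (forall z, Num.min u x <= z <= Num.max u x ->
      [/\ is_derive z 1 g (dg z), is_derive z 1 dg (ddg z) & 0 <= ddg z]) ->
  dg u = 0 -> g u <= g x.
Proof.
have [xu H dgu|ux H dgu|-> //] := ltgtP x u.
- have [z xzu|c /andP[xc cu] E] := mean_value xu (g := g) (dg := dg).
    by have [] := H _ xzu.
  have [z /andP[cz zu]|d /andP[cd du] E'] :=
    mean_value cu (g := dg) (dg := ddg).
    by have [] := H z; rewrite ?zu ?(le_trans (ltW xc)).
  have [|_ _ dd0] := H d; first by rewrite (ltW du) (ltW (lt_trans xc cd)).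
  have dc : dg c <= 0 by nra.
  by rewrite -subr_le0 E mulr_le0_ge0// subr_ge0 ltW.
- have [z xzu|c /andP[xc cu] E] := mean_value ux (g := g) (dg := dg).
    by have [] := H _ xzu.
  have [z /andP[cz zu]|d /andP[cd du] E'] :=
    mean_value xc (g := dg) (dg := ddg).
    by have [] := H z; rewrite ?cz/= ?(le_trans zu (ltW cu)).
  have [|_ _ dd0] := H d; first by rewrite (ltW cd) (ltW (lt_trans du cu)).
  have dc : 0 <= dg c by nra.
  by rewrite -subr_ge0 E mulr_ge0// subr_ge0 ltW.
Qed.

(** A negative value at [u] would force a negative slope before [u] and a positive one after it,
    against [ddg <= 0]. *)
Lemma concave_ge0 g dg ddg x y u :
    (forall z, x <= z <= y ->
      [/\ is_derive z 1 g (dg z), is_derive z 1 dg (ddg z) & ddg z <= 0]) ->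
  x <= u <= y -> 0 <= g x -> 0 <= g y -> 0 <= g u.
Proof.
move=> H /andP[xu uy] gx gy; rewrite leNgt; apply/negP => gu.
have {}xu : x < u.
  by rewrite lt_neqAle xu andbT; apply/eqP => E; rewrite E in gx; lra.
have {}uy : u < y.
  by rewrite lt_neqAle uy andbT; apply/eqP => E; rewrite -E in gy; lra.
have [z /andP[xz zu]|c /andP[xc cu] E] := mean_value xu (g := g) (dg := dg).
  by have [] := H z; rewrite ?xz ?(le_trans zu (ltW uy)).
have [z /andP[uz zy]|d /andP[ud dy] E'] := mean_value uy (g := g) (dg := dg).
  by have [] := H z; rewrite ?zy ?(le_trans (ltW xu) uz).
have [z /andP[cz zd]|e /andP[ce ed] E''] :=
    mean_value (lt_trans cu ud) (g := dg) (dg := ddg).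
  by have [] := H z; rewrite ?(le_trans (ltW xc) cz) ?(le_trans zd (ltW dy)).
have [|_ _ dd0] := H e.
  by rewrite (ltW (lt_trans xc ce)) (ltW (lt_trans ed dy)).
have dc : dg c < 0 by rewrite -(pmulr_llt0 _ (_ : 0 < u - x)); lra.
have dd : 0 < dg d by rewrite -(pmulr_lgt0 _ (_ : 0 < y - u)); lra.
nra.
Qed.

End MeanValue.

(** * The function [ln x - x] and its level sets *)

Section LogMinusId.
Context {R : realType}.
Implicit Types a b c m s t v x y : R.

(** The equation relating [alpha] and [beta] says that [psi] takes the same value at both. *)
Definition psi x : R := ln x - x.

Lemma ln_le_subr1 x : 0 < x -> ln x <= x - 1.
Proof.
by move=> x0; rewrite -{1}(subrKC 1 x); apply: le_ln1Dx; lra.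
Qed.

Lemma psi_le_m1 x : 0 < x -> psi x <= -1.
Proof. by move=> /ln_le_subr1; rewrite /psi; lra. Qed.

Lemma ln_sub_le x y : 0 < x -> 0 < y -> ln x - ln y <= (x - y) / y.
Proof.
move=> x0 y0; rewrite -ln_div ?posrE// mulrBl divff ?gt_eqF//.
by apply: ln_le_subr1; rewrite divr_gt0.
Qed.

Lemma psi_nondecreasing x y : 0 < x -> x <= y -> y <= 1 -> psi x <= psi y.
Proof.
move=> x0 xy y1; have y0 : 0 < y by exact: lt_le_trans xy.
have := ln_sub_le x0 y0; rewrite /psi.
suff : (x - y) / y <= x - y by lra.
by rewrite ler_pdivrMr//; nra.
Qed.

Lemma psi_nonincreasing x y : 1 <= x -> x <= y -> psi y <= psi x.
Proof.
move=> x1 xy; have x0 : 0 < x by lra.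
have := @ln_sub_le y x _ x0; rewrite /psi => /(_ ltac:(lra)).
suff : (y - x) / x <= y - x by lra.
by rewrite ler_pdivrMr//; nra.
Qed.

(** As [ln b - ln a = b - a], the tangent of [ln] at [b] gives [1 <= b] and the one at [a] gives
    [a <= 1]. *)
Lemma psi_eq_around1 a b : 0 < a -> a < b -> psi a = psi b -> a <= 1 <= b.
Proof.
rewrite /psi => a0 ab E; have b0 : 0 < b by exact: lt_trans ab.
have := ln_sub_le a0 b0; have := ln_sub_le b0 a0.
rewrite ler_pdivlMr// => E1; rewrite ler_pdivlMr// => E2.
by apply/andP; split; nra.
Qed.

Lemma sinh_ge t : 0 <= t -> 2 * t <= expR t - expR (- t).
Proof.
rewrite le_eqVlt => /predU1P[<-|t0]; first by rewrite oppr0 mulr0 subrr.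
have [z _|c _] := mean_value t0 (g := fun x => expR x - expR (- x))
    (dg := fun x => expR x + expR (- x)).
  have h : is_derive z 1 (expR \o -%R) (expR (- z) * -1).
    exact: is_derive1_comp.
  by apply: (is_derive_congr (is_deriveB (is_derive_expR z) h)) => //; ring.
rewrite oppr0 expR0 subrr oppr0 !addr0 => ->; rewrite ler_pM2r//.
by have := expR_ge1Dx c; have := expR_ge1Dx (- c); lra.
Qed.

(* With [b = a + 2 t], the equation [psi a = psi b] says [a (e^(2 t) - 1) = 2 t],
   that is [a e^t = t / sinh t]. *)
Lemma psi_eq_ln_add_le0 a b : 0 < a -> a <= b -> a <= 1 -> psi a = psi b ->
  ln a + ln b <= 0.
Proof.
rewrite le_eqVlt /psi => a0 /predU1P[<-|ab] a1 E.
  by have := ln_le_subr1 a0; lra.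
have b0 : 0 < b by exact: lt_trans ab.
pose t := (b - a) / 2.
have t0 : 0 < t by rewrite /t; lra.
have bE : b = a * expR t * expR t.
  by rewrite -{1}(lnK b0) -{1}(lnK a0) -!expRD; congr expR; rewrite /t; lra.
have := sinh_ge (ltW t0); set e := expR t in bE *.
have e0 : 0 < e by exact: expR_gt0.
rewrite expRN -/e => h.
have h2 : 2 * t * e <= e * e - 1.
  by have := ler_wpM2r (ltW e0) h; rewrite mulrBl mulVf ?gt_eqF.
have {}h2 : a * e <= 1.
  have h3 : 2 * t = a * (e * e - 1) by rewrite /t; nra.
  have h4 : 0 < e * e - 1 by rewrite -(pmulr_rgt0 _ a0) -h3; lra.
  by rewrite h3 in h2; rewrite -(ler_pM2r h4); lra.
have : ln (a * e) <= 0 by exact: ln_le0.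
by rewrite lnM ?posrE// /e expRK /t; lra.
Qed.

Lemma is_derive_psi x : 0 < x -> is_derive x 1 psi (x^-1 - 1).
Proof.
move=> x0.
exact: (is_derive_congr (is_deriveB (is_derive1_ln x0) (is_derive_id x 1))).
Qed.

Lemma psi_continuous x y : 0 < x -> {within `[x, y], continuous psi}.
Proof.
move=> x0; apply: derivable_within_continuous => z; rewrite in_itv/=.
by move=> /andP[xz _]; have [] := is_derive_psi (lt_le_trans x0 xz).
Qed.

Lemma psi_preimage a b : 0 < a -> 0 < b -> a <= 1 -> psi a <= psi b ->
  exists c, [/\ 1 <= c, b <= c & psi a = psi c].
Proof.
move=> a0 b0 a1 ab; pose d := Num.max 1 b.
have d1 : 1 <= d by rewrite le_max lexx.
have bd : b <= d by rewrite le_max lexx orbT.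
have ad : psi a <= psi d.
  rewrite /d; case: (leP b 1) => _; last by [].
  exact: psi_nondecreasing.
have am1 := psi_le_m1 a0.
(* Large enough for the intermediate value theorem: [ln M <= M / 2] gives
   [psi M <= - M / 2 = psi a - d / 2]. *)
pose M := d - 2 * psi a.
have dM : d <= M by rewrite /M; lra.
have M0 : 0 < M by lra.
have Ma : psi M <= psi a.
  have : ln (M / 2) <= M / 2 - 1 by apply: ln_le_subr1; lra.
  have ln2 : ln 2 <= 1 :> R by apply: (le_trans (ln_le_subr1 _)); lra.
  have ME : M = d - 2 * psi a by [].
  by rewrite ln_div ?posrE ?ltr0n// [psi M]/psi; lra.
have d0 : 0 < d by lra.
have [|c] := @IVT _ psi d M (psi a) dM (@psi_continuous _ _ d0).
  by rewrite ge_min le_max ad Ma orbT.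
rewrite in_itv/= => /andP[dc _] E; exists c; split=> //; exact: le_trans dc.
Qed.

Definition dpsi_sym m t : R := (m + t)^-1 + (m - t)^-1 - 2.

Lemma is_derive_psi_sym m t : 0 <= t < m ->
  is_derive t 1 (fun t => psi (m + t) - psi (m - t)) (dpsi_sym m t).
Proof.
move=> /andP[t0 tm].
have h1 : is_derive (m + t) 1 psi ((m + t)^-1 - 1) by apply: is_derive_psi; lra.
have h2 : is_derive (m - t) 1 psi ((m - t)^-1 - 1) by apply: is_derive_psi; lra.
have h3 : is_derive t 1 (psi \o (cst m + id)) (((m + t)^-1 - 1) * (0 + 1)).
  exact: is_derive1_comp.
have h4 : is_derive t 1 (psi \o (cst m - id)) (((m - t)^-1 - 1) * (0 - 1)).
  exact: is_derive1_comp.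
by apply: (is_derive_congr (is_deriveB h3 h4)) => //; rewrite /dpsi_sym; ring.
Qed.

Lemma dpsi_symE m t : 0 <= t < m -> dpsi_sym m t = 2 * m / (m ^+ 2 - t ^+ 2) - 2.
Proof.
move=> tm; rewrite /dpsi_sym; field; apply/and3P; split; apply/eqP; nra.
Qed.

Lemma dpsi_sym_nondecreasing m t s : 0 <= t -> t <= s -> s < m ->
  dpsi_sym m t <= dpsi_sym m s.
Proof.
move=> t0 ts sm; rewrite !dpsi_symE ?t0 ?sm ?(le_trans t0) ?(le_lt_trans ts)//.
rewrite lerD2r ler_pM2l; last by lra.
by rewrite lef_pV2 ?posrE; nra.
Qed.

Lemma dpsi_sym_ge0 m t : 0 <= t < m -> m <= 1 -> 0 <= dpsi_sym m t.
Proof.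
move=> tm m1; rewrite dpsi_symE// subr_ge0 ler_pdivlMr; last by nra.
by nra.
Qed.

(** The derivative of [psi (m + t) - psi (m - t)] is at least [2 / m - 2], which is nonnegative as
    the midpoint [m] is at most 1. *)
Lemma psi_le_add_le2 a b : 0 < a -> a <= b -> a + b <= 2 -> psi a <= psi b.
Proof.
rewrite le_eqVlt => a0 /predU1P[->//|ab] ab2.
pose m := (a + b) / 2; pose t := (b - a) / 2.
have t0 : 0 < t by rewrite /t; lra.
have [z /andP[z0 zt]|c /andP[c0 ct]] :=
    mean_value t0 (g := fun t => psi (m + t) - psi (m - t)) (dg := dpsi_sym m).
  by apply: is_derive_psi_sym; rewrite z0 (le_lt_trans zt)// /t /m; lra.
have -> : m + t = b by rewrite /m /t; field.
have -> : m - t = a by rewrite /m /t; field.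
rewrite addr0 oppr0 !addr0 subrr subr0 => E.
have : 0 <= dpsi_sym m c.
  by apply: dpsi_sym_ge0; rewrite /m ?(ltW c0)/=; move: ct; rewrite /t; lra.
by move=> h; rewrite -subr_ge0 E mulr_ge0// ltW.
Qed.

(* [t |-> psi (m + t) - psi (m - t)] has a nondecreasing derivative on [[0, m[]
   and vanishes at [0] and at [(d - c) / 2], so it is nonnegative beyond. *)
Lemma psi_le_outside a b c d : 0 < a -> a < c -> c < d -> a + b = c + d ->
  psi c = psi d -> psi a <= psi b.
Proof.
move=> a0 ac cd abcd E.
pose m := (c + d) / 2; pose t := (d - c) / 2; pose s := (b - a) / 2.
have t0 : 0 < t by rewrite /t; lra.
have ts : t < s by rewrite /t /s; lra.
have sm : s < m by rewrite /s /m; lra.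
pose g t := psi (m + t) - psi (m - t).
have gP z : 0 <= z <= s -> is_derive z 1 g (dpsi_sym m z).
  move=> /andP[z0 zs]; apply: is_derive_psi_sym.
  by rewrite z0 (le_lt_trans zs).
have g0 : g 0 = 0 by rewrite /g addr0 oppr0 addr0 subrr.
have gt : g t = 0.
  have mt : m + t = d by rewrite /m /t; field.
  have mt' : m - t = c by rewrite /m /t; field.
  by rewrite /g mt mt' E subrr.
have [z /andP[z0 zt]|y /andP[y0 yt]] := mean_value t0 (g := g) (dg := dpsi_sym m).
  by apply: gP; rewrite z0 (le_trans zt) ?ltW.
rewrite gt g0 subrr subr0 => /esym/eqP; rewrite mulf_eq0 (gt_eqF t0) orbF => /eqP dy.
have [z /andP[zt zs]|z /andP[tz zs] gs] := mean_value ts (g := g) (dg := dpsi_sym m).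
  by apply: gP; rewrite zs (le_trans (ltW t0)).
have dz : 0 <= dpsi_sym m z.
  rewrite -dy; apply: dpsi_sym_nondecreasing; first exact: ltW.
    exact/ltW/(lt_trans yt).
  exact: lt_trans sm.
have ms : m + s = b by rewrite /m /s; lra.
have ms' : m - s = a by rewrite /m /s; lra.
have gb : psi b - psi a = g s by rewrite /g ms ms'.
have : 0 <= g s - g t by rewrite gs mulr_ge0// subr_ge0 ltW.
by rewrite gt -gb; lra.
Qed.

End LogMinusId.

(** * The gap between [f0] and its tangent planes *)

Section Tangent.
Context {R : realType}.
Implicit Types a b c x y z : R.

(** The gap between [f0] and its tangent plane at [(a, b)], minimised over the second variable. *)
Definition slice a b x : R :=
  x * (ln x - ln a) - x + a + b * (1 - expR (a - x) - (x - a)).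

Definition dslice a b x : R := ln x - ln a + b * (expR (a - x) - 1).

Definition ddslice a b x : R := x^-1 - b * expR (a - x).

Lemma is_derive_expR_sub a x :
  is_derive x 1 (fun x => expR (a - x)) (- expR (a - x)).
Proof.
have h : is_derive x 1 (expR \o (cst a - id)) (expR (a - x) * (0 - 1)).
  exact: is_derive1_comp.
by apply: (is_derive_congr h) => //; ring.
Qed.

Lemma is_derive_slice a b x : 0 < x -> is_derive x 1 (slice a b) (dslice a b x).
Proof.
move=> x0.
have h1 := is_deriveM (is_derive_id x 1)
  (is_deriveB (is_derive1_ln x0) (is_derive_cst (ln a) x 1)).
have h2 := is_deriveZ b (is_deriveB (is_deriveB (is_derive_cst (1 : R) x 1)
  (is_derive_expR_sub a x))
  (is_deriveB (is_derive_id x 1) (is_derive_cst a x 1))).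
apply: (is_derive_congr (is_deriveD (is_deriveD (is_deriveB h1
  (is_derive_id x 1)) (is_derive_cst a x 1)) h2)) => //.
rewrite /dslice /= /GRing.scale/= /cst !fctE.
by field; rewrite gt_eqF.
Qed.

Lemma is_derive_dslice a b x : 0 < x ->
  is_derive x 1 (dslice a b) (ddslice a b x).
Proof.
move=> x0.
apply: (is_derive_congr (is_deriveD
  (is_deriveB (is_derive1_ln x0) (is_derive_cst (ln a) x 1))
  (is_deriveZ b (is_deriveB (is_derive_expR_sub a x)
    (is_derive_cst (1 : R) x 1))))) => //.
by rewrite /ddslice /GRing.scale/=; ring.
Qed.

Lemma ddslice_ge0 a b x : 0 < b -> 0 < x ->
  (0 <= ddslice a b x) = (psi x + ln b + a <= 0).
Proof.
move=> b0 x0; rewrite subr_ge0 -{1}(lnK b0) -{2}(lnK x0) -expRN -expRD ler_expR /psi.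
by apply/idP/idP; lra.
Qed.

Lemma ddslice_le0 a b x : 0 < b -> 0 < x ->
  (ddslice a b x <= 0) = (0 <= psi x + ln b + a).
Proof.
move=> b0 x0; rewrite subr_le0 -{1}(lnK b0) -{1}(lnK x0) -expRN -expRD ler_expR.
by rewrite /psi; apply/idP/idP; lra.
Qed.

Lemma dslice_start a b : 0 < a -> dslice a b a = 0.
Proof. by move=> a0; rewrite /dslice !subrr expR0 subrr mulr0 addr0. Qed.

Lemma slice_start a b : slice a b a = 0.
Proof. by rewrite /slice !subrr expR0 subrr subr0 !mulr0; ring. Qed.

Lemma expR_sub_psi_eq a b : 0 < a -> 0 < b -> psi a = psi b ->
  expR (a - b) = a / b.
Proof.
move=> a0 b0; rewrite /psi => E.
have -> : a - b = ln a - ln b by lra.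
by rewrite expRD expRN !lnK ?posrE.
Qed.

Lemma dslice_end a b : 0 < a -> 0 < b -> psi a = psi b -> dslice a b b = 0.
Proof.
move=> a0 b0 E; rewrite /dslice expR_sub_psi_eq//.
have -> : b * (a / b - 1) = a - b by field; rewrite gt_eqF.
by move: E; rewrite /psi; lra.
Qed.

Lemma slice_end a b : 0 < a -> 0 < b -> psi a = psi b -> slice a b b = 0.
Proof.
move=> a0 b0 E; rewrite /slice expR_sub_psi_eq//.
have -> : b * (1 - a / b - (b - a)) = b - a - b * (b - a).
  by field; rewrite gt_eqF.
have -> : ln b - ln a = b - a by move: E; rewrite /psi; lra.
by ring.
Qed.

(* [slice a b] is convex where [psi <= - (ln b + a)], that is on some
   [[0, p]] and [[q, +oo[] with [a <= p <= 1 <= q <= b], and concave on [[p, q]];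
   [a] and [b] are double zeros. *)
Lemma slice_ge0_curve a b x : 0 < a -> a <= 1 -> 1 <= b -> psi a = psi b ->
  0 < x -> 0 <= slice a b x.
Proof.
move=> a0 a1 b1 E x0; have b0 : 0 < b by lra.
have lnab : ln a + ln b <= 0.
  by apply: psi_eq_ln_add_le0 => //; exact: le_trans b1.
have dP z : 0 < z -> is_derive z 1 (slice a b) (dslice a b z) by exact: is_derive_slice.
have ddP z : 0 < z -> is_derive z 1 (dslice a b) (ddslice a b z)
  by exact: is_derive_dslice.
(* The left side is [ln a + ln b], so both double zeros lie where [slice] is convex. *)
have psia : psi a + ln b + a <= 0 by rewrite /psi; lra.
have left_of z y : 0 < z -> y <= 1 -> psi y + ln b + a <= 0 -> z <= y ->
    0 <= ddslice a b z.
  move=> z0 y1 py zy; rewrite ddslice_ge0//.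
  by have := psi_nondecreasing z0 zy y1; lra.
have right_of z y : 1 <= y -> psi y + ln b + a <= 0 -> y <= z ->
    0 <= ddslice a b z.
  move=> y1 py yz; rewrite ddslice_ge0//; last by lra.
  by have := psi_nonincreasing y1 yz; lra.
have ge_left y : 0 < y -> y <= 1 -> psi y + ln b + a <= 0 -> 0 <= slice a b y.
  move=> y0 y1 py; rewrite -(slice_start a b).
  apply: (convex_ge_critical (dg := dslice a b) (ddg := ddslice a b));
    last exact: dslice_start.
  move=> z /andP[]; rewrite ge_min le_max => az zy.
  have z0 : 0 < z by case/orP: az; exact: lt_le_trans.
  split; [exact: dP|exact: ddP|].
  by case/orP: zy; exact: left_of.
have ge_right y : 1 <= y -> psi y + ln b + a <= 0 -> 0 <= slice a b y.
  move=> y1 py; rewrite -(slice_end a0 b0 E).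
  apply: (convex_ge_critical (dg := dslice a b) (ddg := ddslice a b));
    last exact: dslice_end.
  move=> z /andP[]; rewrite ge_min le_max => bz zy.
  have z0 : 0 < z by case/orP: bz; apply: lt_le_trans; lra.
  split; [exact: dP|exact: ddP|].
  case/orP: bz; apply: right_of => //; rewrite -?E//.
have [px|px] := leP (psi x + ln b + a) 0.
  by have [x1|/ltW x1] := leP x 1; [exact: ge_left|exact: ge_right].
have [xa|ax] := leP x a.
  by have := psi_nondecreasing x0 xa a1; lra.
have [bx|xb] := leP b x.
  by have := psi_nonincreasing b1 bx; lra.
(* Here [slice] is concave at [x]; [p] and [q] are the inflection points around it, where the convex
   cases already apply. *)
have [|p] := @IVT _ psi a x (- (ln b + a)) (ltW ax) (@psi_continuous _ _ _ a0).
  by rewrite ge_min le_max; apply/andP; split; apply/orP; [left|right]; lra.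
rewrite in_itv/= => /andP[ap px'] pE; have p0 := lt_le_trans a0 ap.
have p1 : p <= 1.
  by rewrite leNgt; apply/negP => p1; have := psi_nonincreasing (ltW p1) px'; lra.
have [|q] := @IVT _ psi x b (- (ln b + a)) (ltW xb) (@psi_continuous _ _ _ x0).
  by rewrite ge_min le_max; apply/andP; split; apply/orP; [right|left]; lra.
rewrite in_itv/= => /andP[xq qb] qE.
have q1 : 1 <= q.
  by rewrite leNgt; apply/negP => /ltW q1; have := psi_nondecreasing x0 xq q1; lra.
apply: (@concave_ge0 _ _ (dslice a b) (ddslice a b) p q).
- move=> z /andP[pz zq]; have z0 := lt_le_trans p0 pz.
  split; [exact: dP|exact: ddP|].
  rewrite ddslice_le0//; have [z1|/ltW z1] := leP z 1.
    by have := psi_nondecreasing p0 pz z1; lra.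
  by have := psi_nonincreasing z1 zq; lra.
- by rewrite px' xq.
- by apply: ge_left => //; lra.
- by apply: ge_right => //; lra.
Qed.

(** The coefficient of [b] in [slice] is nonpositive, as [expR (a - x) >= 1 + a - x]; so raising [b]
    to the [c] with [psi c = psi a] reduces to the curve. *)
Lemma slice_ge0 a b x : 0 < a -> a <= 1 -> 0 < b -> psi a <= psi b ->
  0 <= x -> 0 <= slice a b x.
Proof.
move=> a0 a1 b0 ab x0.
have gt0 z : 0 < z -> 0 <= slice a b z.
  move=> z0.
  have [c [c1 bc E]] := psi_preimage a0 b0 a1 ab.
  have := slice_ge0_curve a0 a1 c1 E z0; rewrite /slice.
  have := expR_ge1Dx (a - z) => h.
  suff : c * (1 - expR (a - z) - (z - a)) <= b * (1 - expR (a - z) - (z - a)) by lra.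
  by rewrite ler_wnM2r//; lra.
move: x0; rewrite le_eqVlt => /predU1P[<-|]; last exact: gt0.
rewrite leNgt; apply/negP => lt0.
(* The value at 0 is approached from the right: [slice a b z <= slice a b 0 + z * C] for
   [0 < z <= a], so a negative value at 0 would persist for small [z]. *)
pose C := b * expR a - 1 - b.
have h z : 0 < z -> z <= a -> 0 <= slice a b 0 + z * C.
  move=> z0 za; apply: le_trans (gt0 _ z0) _.
  have h1 : z * (ln z - ln a) <= 0.
    by rewrite pmulr_rle0// subr_le0 ler_ln// posrE.
  have h2 : expR a * (1 - z) <= expR (a - z).
    by rewrite expRD ler_pM2l ?expR_gt0// expR_ge1Dx.
  have h3 : b * (expR a * (1 - z)) <= b * expR (a - z) by rewrite ler_pM2l.
  by rewrite /slice /C mul0r !subr0; lra.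
have C0 : 0 < C.
  rewrite ltNge; apply/negP => C0; have := h a a0 (lexx a).
  have : a * C <= 0 by rewrite pmulr_rle0.
  by lra.
(* At this [d] the bound is half of [slice a b 0], still negative; if [d > a], the point [a] does
   instead. *)
pose d := - slice a b 0 / (2 * C).
have d0 : 0 < d by rewrite divr_gt0//; lra.
have dC : d * C = - slice a b 0 / 2 by rewrite /d; field; rewrite gt_eqF.
have [da|ad] := leP d a.
  by have := h d d0 da; lra.
have : a * C < d * C by rewrite ltr_pM2r.
by have := h a a0 (lexx a); lra.
Qed.

(** The convex function [y ln y] lies above its tangent line at [c]. *)
Lemma gibbs y c : 0 < c -> 0 <= y -> 0 <= y * ln y - y * ln c - y + c.
Proof.
rewrite le_eqVlt => c0 /predU1P[<-|y0]; first by rewrite !mul0r; lra.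
have := ln_sub_le c0 y0; rewrite ler_pdivlMr//; lra.
Qed.

Definition tangent a b x y : R :=
  f0 (a, b) + (ln a + 1 + b) * (x - a) + (ln b + 1 + a) * (y - b).

Lemma tangentC a b x y : tangent a b x y = tangent b a y x.
Proof. by rewrite /tangent /f0/=; ring. Qed.

Lemma f0C x y : f0 (x, y) = f0 (y, x) :> R.
Proof. by rewrite /f0/=; ring. Qed.

(* Minimising [f0 (x, y) - tangent a b x y] over [y] at fixed [x] gives
   [slice a b x], attained at [y = b * expR (a - x)]. *)
Lemma tangent_le a b x y : 0 < a -> a <= 1 -> 0 < b -> psi a <= psi b ->
  0 <= x -> 0 <= y -> tangent a b x y <= f0 (x, y).
Proof.
move=> a0 a1 b0 ab x0 y0.
have := slice_ge0 a0 a1 b0 ab x0.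
have c0 : 0 < b * expR (a - x) by rewrite mulr_gt0// expR_gt0.
have := gibbs c0 y0; rewrite lnM ?posrE ?expR_gt0// expRK.
rewrite /slice /tangent /f0/=; lra.
Qed.

End Tangent.

(** * Convexity of affine functions and of [x ln x] *)

Section Convexity.
Context {R : realType}.
Implicit Types (t : {i01 R}) (p q : R^o * R^o).

Lemma conv_pairE t p q :
  conv t (p : convex_lmodType (R^o * R^o)%type) q =
  (t%:num * p.1 + (1 - t%:num) * q.1, t%:num * p.2 + (1 - t%:num) * q.2).
Proof. by []. Qed.

Lemma affine_convex (D : set (R^o * R^o)) (c u v : R) :
  convex_function D (fun p : R^o * R^o => c + u * p.1 + v * p.2 : R^o).
Proof.
move=> t p q _ _; rewrite conv_pairE convRE /unstable.onem/=.
by rewrite le_eqVlt; apply/orP; left; apply/eqP; ring.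
Qed.

(** Averaging the [gibbs] inequalities of [x] and [y] at their barycentre [w] cancels the linear
    terms. *)
Lemma mul_ln_convex (t x y : R) : 0 <= t <= 1 -> 0 <= x -> 0 <= y ->
  (t * x + (1 - t) * y) * ln (t * x + (1 - t) * y) <=
    t * (x * ln x) + (1 - t) * (y * ln y).
Proof.
move=> /andP[t0 t1] x0 y0; set w := t * x + (1 - t) * y.
have tx : 0 <= t * x by rewrite mulr_ge0.
have ty : 0 <= (1 - t) * y by rewrite mulr_ge0 ?subr_ge0.
have [w0|w0] := leP w 0.
  have wE : w = 0 by rewrite /w in w0 *; lra.
  have txE : t * x = 0 by rewrite /w in w0; lra.
  have tyE : (1 - t) * y = 0 by rewrite /w in w0; lra.
  by rewrite wE !mulrA txE tyE !mul0r addr0.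
have hx := mulr_ge0 t0 (gibbs w0 x0).
have hy := mulr_ge0 (_ : 0 <= 1 - t) (gibbs w0 y0).
have {}hy := hy ltac:(by rewrite subr_ge0).
have wl : w * ln w = t * x * ln w + (1 - t) * y * ln w by rewrite /w; ring.
by rewrite wl; rewrite /w in hx hy *; lra.
Qed.

End Convexity.

(** * The curve, the regions on both sides of it, and the envelope *)

Section CommonTangent.
Context {R : realType}.
Context (alpha beta : R -> R) (hab : alpha_beta_spec alpha beta).
Implicit Types (s t x y : R) (p q : R^o * R^o).

(** For [s > 2], [psi_eq_around1] places 1 between the two values; at [s = 2] both are 1. *)
Lemma alpha_betaP s : 2 <= s ->
  [/\ 0 < alpha s, alpha s <= 1, 1 <= beta s, alpha s + beta s = s &
      psi (alpha s) = psi (beta s)].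
Proof.
have [_ _ a2 b2 H] := hab.
rewrite le_eqVlt => /predU1P[<-|s2]; first by rewrite a2 b2; split=> //; lra.
have [a0 a_lt lt_b abs E] := H _ s2.
have E' : psi (alpha s) = psi (beta s) by rewrite /psi; lra.
have ab : alpha s < beta s by lra.
by have /andP[] := psi_eq_around1 a0 ab E'; split.
Qed.

Lemma alpha_lt_beta s : 2 < s -> alpha s < beta s.
Proof. by have [_ _ _ _ H] := hab; move=> /H[_ ? ? _ _]; lra. Qed.

(* The two coordinates of the gradient of [f0] at [(alpha s, beta s)] coincide. *)
Definition slope s : R := ln (alpha s) + 1 + beta s.

Lemma common_tangent_le s x y : 2 <= s -> 0 <= x -> 0 <= y ->
  ftilde alpha beta s + slope s * (x + y - s) <= f0 (x, y).
Proof.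
move=> /alpha_betaP[a0 a1 b1 abs E] x0 y0.
have b0 : 0 < beta s by lra.
have := tangent_le a0 a1 b0 _ x0 y0; rewrite E lexx => /(_ isT).
apply: le_trans; rewrite /tangent /ftilde /slope.
have -> : ln (beta s) + 1 + alpha s = ln (alpha s) + 1 + beta s.
  by move: E; rewrite /psi; lra.
have -> : x + y - s = (x - alpha s) + (y - beta s) by lra.
by lra.
Qed.

(** This is the common tangent at [s], read at the point [(alpha t, beta t)]. *)
Lemma ftilde_subgradient s t : 2 <= s -> 2 <= t ->
  ftilde alpha beta s + slope s * (t - s) <= ftilde alpha beta t.
Proof.
move=> s2 /alpha_betaP[a0 _ b1 abt _]; rewrite -{1}abt.
by apply: common_tangent_le => //; lra.
Qed.

Lemma slope_continuous : {within `[2, +oo[, continuous slope}.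
Proof.
have [ca cb _ _ _] := hab.
apply/subspace_continuousP => s /= sD.
have s2 : 2 <= s by move: sD; rewrite in_itv/= andbT.
have [a0 _ _ _ _] := alpha_betaP s2.
have /(_ s sD) ca_s := (subspace_continuousP _ _).1 ca.
have /(_ s sD) cb_s := (subspace_continuousP _ _).1 cb.
have cln := cvg_comp _ _ ca_s (continuous_ln a0).
by apply: cvgD cb_s; apply: cvgD (cvg_cst _); exact: cln.
Qed.

(** The subgradient inequalities at [s] and [t] squeeze the difference quotient between [slope s]
    and [slope t], and [slope] is continuous. *)
Lemma C1_ftilde : C1_on `[2, +oo[ (ftilde alpha beta).
Proof.
exists slope; split; first exact: slope_continuous.
move=> s /= sD; have s2 : 2 <= s by move: sD; rewrite in_itv/= andbT.
have /(_ s sD) cs := (subspace_continuousP _ _).1 slope_continuous.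
apply/cvgrPdist_lt => e e0.
have /cvgrPdist_lt/(_ _ e0) {cs} := cs.
rewrite /dnbhs /within /prop_near1 /= /from_subspace.
apply: (@filterS _ (nbhs s)) => t /= h ts tD; move: (h tD).
have t2 : 2 <= t by move: tD; rewrite in_itv/= andbT.
apply: le_lt_trans.
have h1 := ftilde_subgradient s2 t2; have h2 := ftilde_subgradient t2 s2.
have tsE : t - s != 0 by rewrite subr_eq0.
set q := (_ / _).
have qE : ftilde alpha beta t - ftilde alpha beta s = q * (t - s).
  by rewrite /q divfK.
have [lt_ts|lt_st|E] := ltgtP t s; last by rewrite E eqxx in ts.
- have q1 : q <= slope s by rewrite -(ler_nM2r (_ : t - s < 0)) ?subr_lt0//; lra.
  have q2 : slope t <= q by rewrite -(ler_nM2r (_ : t - s < 0)) ?subr_lt0//; lra.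
  rewrite !ger0_norm; lra.
- have q1 : slope s <= q by rewrite -(ler_pM2r (_ : 0 < t - s)) ?subr_gt0//; lra.
  have q2 : q <= slope t by rewrite -(ler_pM2r (_ : 0 < t - s)) ?subr_gt0//; lra.
  rewrite !ler0_norm; lra.
Qed.

(** Both coordinates are at least [alpha (p.1 + p.2)]. Hence [f] is [f0] on the axes. *)
Lemma setA_interior p : setA alpha beta p -> 0 < p.1 /\ 0 < p.2.
Proof.
move=> [_ /alpha_betaP[a0 a1 b1 ab _] le1 le2].
by split; [exact: lt_le_trans le1|lra].
Qed.

Lemma f_on_setA p : setA alpha beta p ->
  f alpha beta p = ftilde alpha beta (p.1 + p.2).
Proof. by move=> pA; rewrite /f mem_set. Qed.

Lemma f_off_setA p : ~ setA alpha beta p -> f alpha beta p = f0 p.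
Proof. by move=> pA; rewrite /f memNset. Qed.

Lemma setAC x y : setA alpha beta (x, y) -> setA alpha beta (y, x).
Proof.
move=> [[/= x0 y0] s2 le1 le2]; have [_ _ _ ab _] := alpha_betaP s2.
by split=> //=; rewrite addrC//; lra.
Qed.

(** When [x + y > 2], the interval from [x] to [y] strictly contains the one from [alpha] to [beta]
    for the same sum, so [psi_le_outside] applies. *)
Lemma setB_psi_le x y : 0 < x -> x <= y -> ~ setA alpha beta (x, y) ->
  x <= 1 /\ psi x <= psi y.
Proof.
move=> x0 xy nA; have [xy2|xy2] := leP (x + y) 2.
  by split; [lra|exact: psi_le_add_le2].
have [a0 a1 b1 ab E] := alpha_betaP (ltW xy2).
have lt_ab := alpha_lt_beta xy2.
have xa : x < alpha (x + y).
  rewrite ltNge; apply/negP => ax; apply: nA; split=> //=; [|exact: ltW|lra].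
  by split=> /=; lra.
split; first by lra.
by apply: (psi_le_outside x0 xa lt_ab).
Qed.

Lemma tangent_le_setB x y u v : 0 < x -> 0 < y -> ~ setA alpha beta (x, y) ->
  0 <= u -> 0 <= v -> tangent x y u v <= f0 (u, v).
Proof.
wlog xy : x y u v / x <= y.
  move=> H x0 y0 nA u0 v0; have [xy|/ltW yx] := leP x y; first exact: H.
  by rewrite tangentC f0C; apply: H => // /setAC.
move=> x0 y0 nA u0 v0; have [x1 le_psi] := setB_psi_le x0 xy nA.
exact: tangent_le.
Qed.

Lemma support p : 0 < p.1 -> 0 < p.2 -> exists c u v : R,
  (forall q, quadrant q -> c + u * q.1 + v * q.2 <= f0 q) /\
  c + u * p.1 + v * p.2 = f alpha beta p.
Proof.
move=> p10 p20; have [pA|pB] := pselect (setA alpha beta p).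
  have s2 : 2 <= p.1 + p.2 by case: pA.
  exists (ftilde alpha beta (p.1 + p.2) - slope (p.1 + p.2) * (p.1 + p.2)),
    (slope (p.1 + p.2)), (slope (p.1 + p.2)); split; last first.
    by rewrite f_on_setA//; lra.
  move=> [x y] [/= x0 y0]; apply: le_trans (common_tangent_le s2 x0 y0).
  by rewrite mulrBr mulrDr; lra.
case: p p10 p20 pB => a b /= a0 b0 pB.
exists (f0 (a, b) - (ln a + 1 + b) * a - (ln b + 1 + a) * b),
  (ln a + 1 + b), (ln b + 1 + a); split; last first.
  by rewrite f_off_setA//; lra.
move=> [x y] [/= x0 y0]; apply: le_trans (tangent_le_setB a0 b0 pB x0 y0).
by rewrite /tangent; lra.
Qed.

Lemma le_envelope (h : R^o * R^o -> R) : convex_function (@quadrant R) h ->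
    (forall q, quadrant q -> h q <= f0 q) ->
  forall p, quadrant p -> h p <= f alpha beta p.
Proof.
move=> hconv hf0 p pQ.
have [pA|pB] := pselect (setA alpha beta p); last by rewrite f_off_setA// hf0.
rewrite f_on_setA//; case: p pA {pQ} => x y [_ /= s2 le1 le2].
have [a0 a1 b1 ab E] := alpha_betaP s2.
set s := x + y in s2 le1 le2 a0 a1 b1 ab E *.
have fab : h (alpha s, beta s) <= ftilde alpha beta s.
  by apply: hf0; split=> /=; lra.
have fba : h (beta s, alpha s) <= ftilde alpha beta s.
  by rewrite /ftilde f0C; apply: hf0; split=> /=; lra.
have [abE|] := eqVneq (alpha s) (beta s).
  have <- // : (alpha s, beta s) = (x, y).
  by congr pair; rewrite /s in le1 le2 ab abE *; lra.
rewrite neq_lt => /orP[lt_ab|]; last by lra.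
(* This weight gives the barycentre of the two curve points the first coordinate [x]; the second is
   then [y], since all sums are [s]. *)
have t0 : 0 <= (beta s - x) / (beta s - alpha s) by rewrite divr_ge0//; lra.
have t1 : (beta s - x) / (beta s - alpha s) <= 1.
  by rewrite ler_pdivrMr; lra.
have := hconv (Itv01 t0 t1) (alpha s, beta s) (beta s, alpha s).
rewrite !inE => /(_ (conj _ _) (conj _ _)).
set tau := (_ / _) in t0 t1 *.
have tauE : tau * (beta s - alpha s) = beta s - x.
  by rewrite divfK// subr_eq0 gt_eqF.
have -> : conv (Itv01 t0 t1)
    ((alpha s, beta s) : convex_lmodType (R^o * R^o)%type) (beta s, alpha s) =
    (x, y).
  by rewrite conv_pairE/=; congr pair; rewrite /s in ab *; lra.
rewrite convRE /= /unstable.onem => /(_ _ _ _ _)/le_trans; apply; try lra.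
have h1 : tau * h (alpha s, beta s) <= tau * ftilde alpha beta s.
  by rewrite ler_wpM2l.
have h2 : (1 - tau) * h (beta s, alpha s) <= (1 - tau) * ftilde alpha beta s.
  by rewrite ler_wpM2l// subr_ge0.
by lra.
Qed.

(** The plane supporting at an interior barycentre is a convex minorant of [f0], so [le_envelope]
    puts it below [f] at both ends. *)
Lemma f_convex : convex_function (@quadrant R) (f alpha beta).
Proof.
move=> t x y; rewrite !inE => xQ yQ.
(* Extreme weights are set aside: with both weights positive, a barycentre on an axis forces both
   ends onto it, where [f] is [x ln x]. *)
have [->|t0] := eqVneq t 0%:i01; first by rewrite !conv0.
have [->|t1] := eqVneq t 1%:i01; first by rewrite !conv1.
have {}t0 : 0 < t%:num by rewrite lt_neqAle eq_sym t0 ge0.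
have {}t1 : 0 < 1 - t%:num by rewrite subr_gt0 lt_neqAle t1 le1.
have t01 : 0 <= t%:num <= 1 by rewrite ge0 le1.
rewrite conv_pairE convRE /unstable.onem.
case: x xQ => x1 x2 [/= x10 x20]; case: y yQ => y1 y2 [/= y10 y20].
set s := t%:num in t0 t1 t01 *.
have zero_of (a b : R) : 0 <= a -> 0 <= b -> s * a + (1 - s) * b <= 0 ->
    a = 0 /\ b = 0.
  move=> a0 b0 sab; have sa : 0 <= s * a by rewrite mulr_ge0// ltW.
  have sb : 0 <= (1 - s) * b by rewrite mulr_ge0// ltW.
  split; apply/eqP.
    by rewrite -(mulrI_eq0 _ (mulfI (lt0r_neq0 t0))); apply/eqP; lra.
  by rewrite -(mulrI_eq0 _ (mulfI (lt0r_neq0 t1))); apply/eqP; lra.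
have [z1_le0|z10] := leP (s * x1 + (1 - s) * y1) 0.
  have [-> ->] := zero_of _ _ x10 y10 z1_le0.
  have fE w : f alpha beta (0, w) = w * ln w.
    rewrite f_off_setA => [|/setA_interior[/=]]; last by rewrite ltxx.
    by rewrite /f0/= !mul0r add0r addr0.
  by rewrite !mulr0 addr0 !fE mul_ln_convex.
have [z2_le0|z20] := leP (s * x2 + (1 - s) * y2) 0.
  have [-> ->] := zero_of _ _ x20 y20 z2_le0.
  have fE w : f alpha beta (w, 0) = w * ln w.
    rewrite f_off_setA => [|/setA_interior[/= _]]; last by rewrite ltxx.
    by rewrite /f0/= !mul0r mulr0 !addr0.
  by rewrite !mulr0 addr0 !fE mul_ln_convex.
have [c [u [v [L LE]]]] :=
  @support (s * x1 + (1 - s) * y1, s * x2 + (1 - s) * y2) z10 z20.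
rewrite -LE /=.
have L_le := le_envelope (@affine_convex _ (@quadrant R) c u v) L.
have hx : s * (c + u * x1 + v * x2) <= s * f alpha beta (x1, x2).
  by rewrite ler_pM2l// (L_le (x1, x2)).
have hy : (1 - s) * (c + u * y1 + v * y2) <= (1 - s) * f alpha beta (y1, y2).
  by rewrite ler_pM2l// (L_le (y1, y2)).
by lra.
Qed.

(** On [A] the supporting plane at [p] takes the value of [f] there and stays below [f0]. *)
Lemma f_le_f0 p : quadrant p -> f alpha beta p <= f0 p.
Proof.
move=> pQ; have [pA|pB] := pselect (setA alpha beta p); last by rewrite f_off_setA.
have [p10 p20] := setA_interior pA.
by have [c [u [v [+ <-]]]] := support p10 p20; exact.
Qed.

End CommonTangent.

Theorem proposition2p1 (R : realType) (alpha beta : R -> R)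
    (hab : alpha_beta_spec alpha beta) :
  C1_on `[2, +oo[ (ftilde alpha beta) /\
  is_convex_envelope (@quadrant R) (f alpha beta) f0.
Proof.
split; first exact: C1_ftilde.
split; [exact: f_convex|exact: f_le_f0|exact: le_envelope].
Qed.
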